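(* Let $a,b,c,d,e,f$ be nonzero integers with $\gcd(a,b)=\gcd(c,d)=\gcd(e,f)=1$, such that none of the three pairs $(a,b)$, $(c,d)$, $(e,f)$ is of the form $(\pm1,\pm1)$ (for any choice of signs), and suppose $a<b$, $c<d$ and $e<f$. Let $Q=Q(a,b;c,d;e,f)$. Then $$|Q|=\bigl(b^{d-c}-a^{d-c}\bigr)\bigl(d^{f-e}-c^{f-e}\bigr)\bigl(f^{b-a}-e^{b-a}\bigr)\cdot k$$ for some integer $k$ dividing $(b-a)^2(d-c)^2(f-e)^2$.
   Context: Conjugation convention: $x^y=y^{-1}xy$. For nonzero integers $a,\dots,f$, $$G(a,b;c,d;e,f)=\bigl\langle x,y,z \bigm| (x^a)^y=x^b,\ (y^c)^z=y^d,\ (z^e)^x=z^f\bigr\rangle .$$ Under the stated coprimality and non-$(\pm1,\pm1)$ hypotheses, $Q(a,b;c,d;e,f)$ denotes the universal quotient of $G(a,b;c,d;e,f)$ in which $x,y,z$ have finite order: $x,y,z$ have finite order in $Q$, and every quotient of $G$ in which $x,y,z$ have finite order factors through $Q$. (It exists and is a finite solvable group; it is obtained from $G$, when $a<b$, $c<d$, $e<f$, by adjoining the relations $x^{(b-a)^2(b^{d-c}-a^{d-c})}=1$, $y^{(d-c)^2(d^{f-e}-c^{f-e})}=1$, $z^{(f-e)^2(f^{b-a}-e^{b-a})}=1$.) The integer $k$ may be negative, since the product of the three displayed differences may be negative. *)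

(* Defs.v *)
From HB Require Import structures.
From mathcomp Require Import all_boot all_order all_algebra.
From mathcomp Require Import boolp classical_sets functions cardinality.

Set Implicit Arguments.
Unset Strict Implicit.
Unset Printing Implicit Defensive.

Import Order.TTheory GRing.Theory Num.Theory.

Local Open Scope group_scope.

(* A letter (i, false) stands for the generator i, and (i, true) for its
   inverse. *)
Definition word (I : Type) : Type := seq (I * bool).

Section Words.
Variable I : Type.
Implicit Types u v w : word I.

Definition wgen (i : I) : word I := [:: (i, false)].
Definition winv w : word I := rev [seq (l.1, ~~ l.2) | l <- w].
Definition wexp w (n : int) : word I :=
  match n with
  | Posz m => flatten (nseq m w)
  | Negz m => flatten (nseq m.+1 (winv w))
  end.
Definition wconj u v : word I := winv v ++ (u ++ v).

Inductive pres_eq (R : word I -> word I -> Prop) : word I -> word I -> Prop :=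
| pres_rel u v of R u v : pres_eq R u v
| pres_cancel i s : pres_eq R [:: (i, s); (i, ~~ s)] [::]
| pres_cat u u' v v' of pres_eq R u u' & pres_eq R v v' :
    pres_eq R (u ++ v) (u' ++ v')
| pres_refl u : pres_eq R u u
| pres_sym u v of pres_eq R u v : pres_eq R v u
| pres_trans u v w of pres_eq R u v & pres_eq R v w : pres_eq R u w.

Lemma winvK : involutive winv.
Proof.
move=> w; rewrite /winv map_rev revK -map_comp -[RHS]map_id.
by apply: eq_map => -[i s] /=; rewrite negbK.
Qed.

Lemma winv_cat u v : winv (u ++ v) = winv v ++ winv u.
Proof. by rewrite /winv map_cat rev_cat. Qed.

Lemma pres_mulV R w : pres_eq R (w ++ winv w) [::].
Proof.
elim: w => [|[i s] w IH]; first exact: pres_refl.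
rewrite -cat1s winv_cat !catA -(catA [:: (i, s)]).
apply: pres_trans (pres_cancel R i s).
apply: (@pres_cat R _ [:: (i, s)] _ [:: (i, ~~ s)]); last exact: pres_refl.
apply: (@pres_cat R _ [:: (i, s)] _ [::] _ IH); exact: pres_refl.
Qed.

Lemma pres_Vmul R w : pres_eq R (winv w ++ w) [::].
Proof. by rewrite -{2}(winvK w); apply: pres_mulV. Qed.

Lemma pres_inv R u v : pres_eq R u v -> pres_eq R (winv u) (winv v).
Proof.
move=> uv; have r := @pres_refl R.
apply: (@pres_trans R _ (winv u ++ (v ++ winv v))).
  rewrite -{1}[winv u]cats0; apply: pres_cat => //.
  exact/pres_sym/pres_mulV.
rewrite catA -[X in pres_eq _ _ X]cat0s; apply: pres_cat => //.
apply: pres_trans (pres_Vmul R u); apply: pres_cat => //; exact: pres_sym.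
Qed.

End Words.

Section PresentedGroup.
Variables (I : choiceType) (R : word I -> word I -> Prop).

Definition pres_eqb : rel (word I) := fun u v => `[< pres_eq R u v >].

Lemma pres_eqb_refl : reflexive pres_eqb.
Proof. by move=> u; apply/asboolP; apply: pres_refl. Qed.
Lemma pres_eqb_sym : symmetric pres_eqb.
Proof. by move=> u v; apply/asboolP/asboolP; apply: pres_sym. Qed.
Lemma pres_eqb_trans : transitive pres_eqb.
Proof.
move=> v u w /asboolP uv /asboolP vw.
by apply/asboolP; apply: pres_trans uv vw.
Qed.

Definition pres_equiv :=
  EquivRel pres_eqb pres_eqb_refl pres_eqb_sym pres_eqb_trans.

(* The group < I | u = v for all u, v such that R u v >. *)
Definition presented_group : Type := {eq_quot pres_equiv}%qT.

HB.instance Definition _ := Choice.on presented_group.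
HB.instance Definition _ := EqQuotient.on presented_group.

Definition pres_class (w : word I) : presented_group :=
  (\pi_presented_group w)%qT.
Definition pres_gen (i : I) : presented_group := pres_class (wgen i).

Lemma pres_classP u v : pres_class u = pres_class v <-> pres_eq R u v.
Proof.
split=> [/eqP | uv].
  by rewrite /pres_class (eqmodE pres_equiv) => /asboolP.
by apply/eqP; rewrite /pres_class (eqmodE pres_equiv); apply/asboolP.
Qed.

Lemma pres_class_surj (g : presented_group) : pres_class (repr g) = g.
Proof. exact: reprK. Qed.

Definition pres_one : presented_group := pres_class [::].
Definition pres_mul (g h : presented_group) : presented_group :=
  pres_class (repr g ++ repr h).
Definition pres_invg (g : presented_group) : presented_group :=
  pres_class (winv (repr g)).

Lemma pres_class_cat u v :
  pres_class (u ++ v) = pres_mul (pres_class u) (pres_class v).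
Proof.
by apply/pres_classP/pres_cat; apply/pres_classP; rewrite pres_class_surj.
Qed.

Lemma pres_mulA : associative pres_mul.
Proof.
move=> f g h; rewrite -(pres_class_surj f) -(pres_class_surj g).
by rewrite -(pres_class_surj h) -!pres_class_cat catA.
Qed.
Lemma pres_mul1 : left_id pres_one pres_mul.
Proof. by move=> g; rewrite -(pres_class_surj g) -pres_class_cat. Qed.
Lemma pres_mulg1 : right_id pres_one pres_mul.
Proof. by move=> g; rewrite -(pres_class_surj g) -pres_class_cat cats0. Qed.
Lemma pres_mulVg : left_inverse pres_one pres_invg pres_mul.
Proof.
move=> g; rewrite -{2}(pres_class_surj g) -pres_class_cat.
exact/pres_classP/pres_Vmul.
Qed.
Lemma pres_mulgV : right_inverse pres_one pres_invg pres_mul.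
Proof.
move=> g; rewrite -{1}(pres_class_surj g) -pres_class_cat.
exact/pres_classP/pres_mulV.
Qed.

HB.instance Definition _ := isGroup.Build presented_group
  pres_mulA pres_mul1 pres_mulg1 pres_mulVg pres_mulgV.

End PresentedGroup.

Definition finite_order (G : groupType) (g : G) : Prop :=
  exists2 n : nat, (0 < n)%N & g ^+ n = 1.

Variant gen : Set := gx | gy | gz.

HB.instance Definition _ := gen_eqMixin gen.
HB.instance Definition _ := gen_choiceMixin gen.

Variant Grel (a b c d e f : int) : word gen -> word gen -> Prop :=
| Grel_xy : Grel a b c d e f
    (wconj (wexp (wgen gx) a) (wgen gy)) (wexp (wgen gx) b)
| Grel_yz : Grel a b c d e f
    (wconj (wexp (wgen gy) c) (wgen gz)) (wexp (wgen gy) d)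
| Grel_zx : Grel a b c d e f
    (wconj (wexp (wgen gz) e) (wgen gx)) (wexp (wgen gz) f).

Notation Ggrp a b c d e f := (presented_group (Grel a b c d e f)).

Section UniversalQuotient.
Variables a b c d e f : int.
Let G : groupType := Ggrp a b c d e f.

Definition finite_order_quotient (H : groupType) (rho : {multiplicative G -> H})
    : Prop :=
  (forall h : H, exists g : G, rho g = h) /\
  (forall i : gen, finite_order (rho (pres_gen (Grel a b c d e f) i))).

(* pi : G -> Q exhibits Q as Q(a,b;c,d;e,f). *)
Definition universal_finite_order_quotient
    (Q : groupType) (pi : {multiplicative G -> Q}) : Prop :=
  finite_order_quotient pi /\
  forall (H : groupType) (rho : {multiplicative G -> H}),
    finite_order_quotient rho ->
    exists phi : {multiplicative Q -> H}, forall g : G, phi (pi g) = rho g.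

End UniversalQuotient.

(* Main.v *)
From HB Require Import structures.
Require Import Defs.
From mathcomp Require Import all_boot all_order all_algebra all_fingroup cyclic.
From mathcomp Require Import zify ring.
From mathcomp Require Import boolp classical_sets functions cardinality.

(** In a group where [x], [y], [z] have finite order, coprimality turns the
    three relations into [x ^ y = x ^+ al], [y ^ z = y ^+ be],
    [z ^ x = z ^+ ga], where [al] represents b/a modulo the order of [x], and
    similarly for [be] and [ga]: since [x^a] and [x^b] are conjugate they have
    the same order, which forces [a] to be invertible modulo the order of [x]
    ([conj_order_coprime], [conj_exponent]).

    Bounded orders.  Computing [x ^ (y ^ z)] in two ways gives
      [x^(al^be - al) = z^-(ga^al - ga) y^-(be^ga - be)]
    ([mennicke_relation]).  Conjugating this by [y], which fixes the power of
    [y] in it, shows that [x^((al^be - al)(al - 1))] is a power of [y], hence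
    commutes with [y], so [x^((al^(be-1) - 1)(al - 1)^2) = 1]
    ([mennicke_exponent]).  Clearing denominators, the order of [x] divides
    [(b-a)^2 (b^(d-c) - a^(d-c))] ([order_dvd_bound]); the relations are
    invariant under cyclic rotation, so the same holds for [y] and [z].  These
    bounds are nonzero and do not depend on the quotient, so adjoining them to
    the presentation of [G] yields a universal quotient.

    Upper bound.  As [<y>] normalizes [<x>], [<z>] normalizes [<y>] and [<x>]
    normalizes [<z>], every element of [Q] has the form [x^i y^j z^k].  So [Q]
    is finite, [<x><y>] is a subgroup, and [Q = <x><y><z>] has order dividing
    the product of the orders of [x], [y], [z] ([finite_model]).

    Lower bound.  Put [n = |b^(d-c) - a^(d-c)|].  Killing [z] leaves room for
    the affine group of Z/n: [x] maps to [t |-> t + 1] and [y] to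
    multiplication by b/a, an element whose order divides [d-c].  There
    [[~ x, y]] is a translation whose order, times [b-a], is a multiple of [n].
    The three rotations of this map, together with the three maps of [Q] onto
    the cyclic groups of orders [b-a], [d-c], [f-e], have successive kernels
    that contain enough commutators to multiply the six contributions, so the
    product of the three differences divides [|Q|] ([card_lower_bound]).

    Comparing both bounds gives the cofactor [k]. *)

Import Order.TTheory GRing.Theory Num.Theory.
Set Implicit Arguments.
Unset Strict Implicit.
Unset Printing Implicit Defensive.
Local Open Scope ring_scope.

(** * Integer powers and orders in arbitrary groups *)

Definition intexp (G : groupType) (g : G) (n : int) : G :=
  match n with Posz m => (g ^+ m)%g | Negz m => (g ^- m.+1)%g end.

Lemma eq_expg_mod (G : groupType) (g : G) (N m k : nat) :
  (g ^+ N = 1)%g -> m = k %[mod N] -> (g ^+ m = g ^+ k)%g.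
Proof.
move=> gN mk; rewrite (divn_eq m N) (divn_eq k N) mk.
by rewrite !expgnDr ![(_ * N)%N]mulnC !expgnA gN !expg1n.
Qed.

(** Integer powers are only taken of elements of finite order, where they are
    natural powers. *)
Lemma intexp_mod (G : groupType) (g : G) (N : nat) (n : int) :
  (0 < N)%N -> (g ^+ N = 1)%g -> intexp g n = (g ^+ `|(n %% N)%Z|)%g.
Proof.
move=> N0 gN; case: n => m /=.
  by rewrite modz_nat absz_nat; apply: eq_expg_mod gN _; rewrite modn_mod.
(* The inverse of [g ^+ m.+1] is [g ^+ r], as [N] divides [m.+1 + r]. *)
set r := `|_|%N.
have rE : r%:Z = (Negz m %% N)%Z by rewrite /r gez0_abs // modz_ge0 //; lia.
have : (g ^+ (m.+1 + r) = 1)%g.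
  rewrite -[RHS](expg0 g); apply: eq_expg_mod gN _.
  apply/eqP; rewrite mod0n -/(dvdn _ _).
  have := divz_eq (Negz m) N; rewrite -rE => E.
  suff: (N%:Z %| (m.+1 + r)%N%:Z)%Z by rewrite dvdzE.
  apply/dvdzP; exists (- (Negz m %/ N)%Z); lia.
by rewrite expgnDr => /mulg1_eq.
Qed.

Lemma eq_intexp_mod (G : groupType) (g : G) (N : nat) (m k : int) :
  (0 < N)%N -> (g ^+ N = 1)%g -> (m = k %[mod N])%Z -> intexp g m = intexp g k.
Proof. by move=> N0 gN E; rewrite !(intexp_mod _ N0 gN) E. Qed.

Lemma intexp1 (G : groupType) (n : int) : intexp (1%g : G) n = 1%g.
Proof. by case: n => n /=; rewrite expg1n ?invg1. Qed.

Lemma finite_order_intexp (G : groupType) (g : G) (n : int) :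
  n != 0 -> intexp g n = 1%g -> finite_order g.
Proof.
case: n => n n0 /= gn; first by exists n => //; rewrite lt0n.
by exists n.+1 => //; apply: invg_inj; rewrite gn invg1.
Qed.

Definition has_order (G : groupType) (g : G) (N : nat) :=
  (0 < N)%N /\ forall k : nat, (g ^+ k = 1)%g <-> (N %| k)%N.

Lemma finite_order_has_order (G : groupType) (g : G) :
  finite_order g -> exists N, has_order g N.
Proof.
move=> [n n0 gn].
have ex : exists n, (0 < n)%N && (g ^+ n == 1)%g.
  by exists n; rewrite n0 gn eqxx.
case: (ex_minnP ex) => N /andP[N0 /eqP gN] Nmin; exists N; split=> // k.
split=> [gk|/dvdnP[q ->]]; last by rewrite mulnC expgnA gN expg1n.
have gkN : (g ^+ (k %% N) = 1)%g.
  by rewrite -gk; apply: eq_expg_mod gN _; rewrite modn_mod.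
rewrite /dvdn -[_ == _]negbK -lt0n; apply/negP => kN.
have := Nmin (k %% N)%N; rewrite kN gkN eqxx => /(_ isT).
by rewrite leqNgt ltn_pmod.
Qed.

Lemma has_order_exp (G : groupType) (g : G) N : has_order g N -> (g ^+ N = 1)%g.
Proof. by case=> _ /(_ N) [_ H]; apply: H. Qed.

Lemma has_order_intexp (G : groupType) (g : G) N (k : int) :
  has_order g N -> (intexp g k = 1)%g <-> (N %| k)%Z.
Proof.
move=> oN; have [N0 oNP] := oN.
rewrite (intexp_mod _ N0 (has_order_exp oN)) oNP.
have -> : (N %| k)%Z = (N %| (k %% N)%Z)%Z.
  by apply/dvdz_mod0P/dvdz_mod0P; rewrite modz_mod.
by rewrite dvdzE absz_nat.
Qed.

Lemma has_order_eq (G : groupType) (g : G) (N m k : nat) :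
  has_order g N -> (g ^+ m = g ^+ k)%g -> m = k %[mod N].
Proof.
move=> [_ oNP].
suff le_case u v : (v <= u)%N -> (g ^+ u = g ^+ v)%g -> u = v %[mod N].
  by case: (leqP k m) => [/le_case//|/ltnW/le_case H /esym/H/esym].
move=> le_vu; rewrite -{1}(subnKC le_vu) expgnDr -{2}[(g ^+ v)%g]mulg1.
move=> /mulgI/oNP/eqP dN.
by rewrite -(subnKC le_vu) -modnDmr dN addn0.
Qed.

Lemma has_order_order (T : finGroupType) (g : T) : has_order g #[g]%g.
Proof.
by split=> // k; rewrite order_dvdn; split=> [->|/eqP].
Qed.

Lemma finite_order_fin (T : finGroupType) (g : T) : finite_order g.
Proof. by exists #[g]%g; rewrite ?order_gt0 ?expg_order. Qed.

Lemma eqmodz_nat (m k N : nat) : (m = k %[mod N])%Z -> m = k %[mod N].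
Proof. by rewrite !modz_nat => -[]. Qed.

(** * Morphisms and words *)

Lemma multiplicative1 (G H : groupType) (f : {multiplicative G -> H}) :
  f 1%g = 1%g.
Proof. by apply: (@mulgI _ (f 1%g)); rewrite -gmulfM !mulg1. Qed.

Lemma multiplicativeV (G H : groupType) (f : {multiplicative G -> H}) (g : G) :
  f g^-1%g = (f g)^-1%g.
Proof. by apply/esym/mulg1_eq; rewrite -gmulfM mulgV multiplicative1. Qed.

Lemma multiplicativeX (G H : groupType) (f : {multiplicative G -> H}) (g : G)
    (n : nat) :
  f (g ^+ n)%g = (f g ^+ n)%g.
Proof.
by elim: n => [|n IH]; rewrite ?expg0 ?multiplicative1 // !expgS gmulfM IH.
Qed.

Lemma multiplicativeJ (G H : groupType) (f : {multiplicative G -> H})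
    (g h : G) :
  f (g ^ h)%g = (f g ^ f h)%g.
Proof. by rewrite /conjg !gmulfM multiplicativeV. Qed.

Lemma multiplicativeR (G H : groupType) (f : {multiplicative G -> H})
    (g h : G) :
  f [~ g, h]%g = [~ f g, f h]%g.
Proof. by rewrite /commg gmulfM multiplicativeV multiplicativeJ. Qed.

Lemma multiplicative_intexp (G H : groupType) (f : {multiplicative G -> H})
    (g : G) (n : int) :
  f (intexp g n) = intexp (f g) n.
Proof. by case: n => n /=; rewrite ?multiplicativeV multiplicativeX. Qed.

Definition word_eval (I : Type) (H : groupType) (v : I -> H) (w : word I) : H :=
  foldr (fun l h => (if l.2 then (v l.1)^-1 else v l.1) * h)%g 1%g w.

Lemma word_eval_cat (I : Type) (H : groupType) (v : I -> H) (u w : word I) :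
  word_eval v (u ++ w) = (word_eval v u * word_eval v w)%g.
Proof. by elim: u => [|l u IH] /=; rewrite ?mul1g // IH mulgA. Qed.

Lemma word_eval_inv (I : Type) (H : groupType) (v : I -> H) (w : word I) :
  word_eval v (winv w) = (word_eval v w)^-1%g.
Proof.
elim: w => [|[i s] w IH]; first by rewrite invg1.
rewrite -cat1s winv_cat word_eval_cat IH word_eval_cat invgM.
by case: s; rewrite /= !mulg1 ?invgK.
Qed.

Lemma word_eval_flatten (I : Type) (H : groupType) (v : I -> H) (w : word I) n :
  word_eval v (flatten (nseq n w)) = (word_eval v w ^+ n)%g.
Proof. by elim: n => [|n IH] //=; rewrite word_eval_cat IH expgS. Qed.

Lemma word_eval_exp (I : Type) (H : groupType) (v : I -> H) (w : word I) n :
  word_eval v (wexp w n) = intexp (word_eval v w) n.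
Proof.
by case: n => n; rewrite word_eval_flatten // word_eval_inv expVgn.
Qed.

Lemma word_eval_gen (I : Type) (H : groupType) (v : I -> H) (i : I) :
  word_eval v (wgen i) = v i.
Proof. by rewrite /= mulg1. Qed.

Lemma word_eval_conj (I : Type) (H : groupType) (v : I -> H) (u w : word I) :
  word_eval v (wconj u w) = (word_eval v u ^ word_eval v w)%g.
Proof. by rewrite /wconj !word_eval_cat word_eval_inv. Qed.

Lemma word_eval_multiplicative (I : Type) (G H : groupType)
    (f : {multiplicative G -> H}) (v : I -> G) (w : word I) :
  f (word_eval v w) = word_eval (f \o v) w.
Proof.
elim: w => [|[i s] w IH]; first exact: multiplicative1.
by rewrite /= gmulfM IH; case: s; rewrite ?multiplicativeV.
Qed.

Lemma word_eval_pres_gen (I : choiceType) (R : word I -> word I -> Prop)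
    (w : word I) :
  word_eval (pres_gen R) w = pres_class R w.
Proof.
elim: w => [|[i s] w IH] //.
rewrite -cat1s word_eval_cat IH pres_class_cat; congr (_ * _)%g.
case: s; rewrite /= mulg1 //; apply: mulg1_eq.
by rewrite -[LHS]pres_class_cat; apply/pres_classP/(pres_cancel R i false).
Qed.

(** The universal property of a presentation (von Dyck). *)
Lemma presented_group_lift (I : choiceType) (R : word I -> word I -> Prop)
    (H : groupType) (v : I -> H) :
  (forall u w, R u w -> word_eval v u = word_eval v w) ->
  exists phi : {multiplicative presented_group R -> H},
    forall w, phi (pres_class R w) = word_eval v w.
Proof.
move=> vR.
have ev_eq u w : pres_eq R u w -> word_eval v u = word_eval v w.
  elim=> {u w} [u w /vR //|i s|u u' w w' _ eu _ ew|//|//|u t w _ -> //].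
    by case: s; rewrite /= mulg1 ?mulgV ?mulVg.
  by rewrite !word_eval_cat eu ew.
pose phi (g : presented_group R) := word_eval v (generic_quotient.repr g).
have phiE w : phi (pres_class R w) = word_eval v w.
  by apply: ev_eq; apply/pres_classP; rewrite pres_class_surj.
have phiM : {morph phi : g h / (g * h)%g}.
  by move=> g h; rewrite [LHS]phiE word_eval_cat.
pose phi_mul := isMultiplicative.Build _ _ phi phiM.
pose Phi : {multiplicative presented_group R -> H} := HB.pack phi phi_mul.
by exists Phi.
Qed.

(** * Bounding the orders of the generators *)

(** Let [g] be the gcd of [a] and [N].  The power [x^a] is killed by [N/g],
    hence so is its conjugate [x^b]; then [g] divides [b] as well as [a]. *)
Lemma conj_order_coprime (G : groupType) (x y : G) (a b : int) (N : nat) :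
  has_order x N -> gcdz a b = 1 -> (intexp x a ^ y)%g = intexp x b ->
  gcdz a N = 1.
Proof.
move=> oN ab rel; have [N0 oNP] := oN; have xN := has_order_exp oN.
move: rel; rewrite !(intexp_mod _ N0 xN).
set a0 := `|_|%N; set b0 := `|_|%N => rel.
have a0E : a0%:Z = (a %% N)%Z by rewrite /a0 gez0_abs // modz_ge0 //; lia.
have b0E : b0%:Z = (b %% N)%Z by rewrite /b0 gez0_abs // modz_ge0 //; lia.
set g := gcdn `|a|%N N.
have gN : (g %| N)%N by apply: dvdn_gcdr.
have ga : (g%:Z %| a)%Z by rewrite dvdzE absz_nat dvdn_gcdl.
have ga0 : (g %| a0)%N.
  suff: (g%:Z %| a0%:Z)%Z by rewrite dvdzE.
  have := divz_eq a N; rewrite -a0E => E.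
  have -> : a0%:Z = a - (a %/ N)%Z * N by lia.
  by rewrite rpredB // dvdz_mull // dvdzE.
have g0 : (0 < g)%N by rewrite gcdn_gt0 N0 orbT.
have [k Nk] := dvdnP gN.
have k0 : (0 < k)%N by lia.
have xa : (x ^+ (a0 * k) = 1)%g.
  by apply/oNP; rewrite Nk mulnC dvdn_pmul2r.
have xb : (x ^+ (b0 * k) = 1)%g.
  by rewrite expgnA -rel -conjXg -expgnA xa conj1g.
have gb0 : (g %| b0)%N by move/oNP: xb; rewrite Nk mulnC dvdn_pmul2r.
have gb : (g%:Z %| b)%Z.
  rewrite (divz_eq b N) -b0E rpredD // ?dvdz_mull // dvdzE //.
have : (g%:Z %| gcdz a b)%Z by rewrite dvdz_gcd ga gb.
by rewrite ab dvdz1 absz_nat => /eqP g1; rewrite /gcdz absz_nat -/g g1.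
Qed.

(** As [a] is invertible modulo the order of [x], the element [x] is a power of
    [x^a], so its conjugate by [y] is the same power of [x^b]. *)
Lemma conj_exponent (G : groupType) (x y : G) (a b : int) (N : nat) :
  has_order x N -> gcdz a b = 1 -> (intexp x a ^ y)%g = intexp x b ->
  exists al : nat, [/\ (0 < al)%N, (x ^ y = x ^+ al)%g
                     & (a * al%:Z = b %[mod N])%Z].
Proof.
move=> oN ab rel; have [N0 oNP] := oN; have xN := has_order_exp oN.
have aN := conj_order_coprime oN ab rel.
have [u [v uv]] := Bezoutz a N; rewrite aN in uv.
(* [s] is an inverse of [a] modulo [N]. *)
pose s := `|(u %% N)%Z|%N.
have sE : s%:Z = (u %% N)%Z by rewrite /s gez0_abs // modz_ge0 //; lia.
have as1 : (a * s%:Z = 1 %[mod N])%Z.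
  rewrite sE modzMmr -uv mulrC; apply/eqP; rewrite eqz_mod_dvd.
  by apply/dvdzP; exists (- v); ring.
have rel' := rel; rewrite !(intexp_mod _ N0 xN) in rel'.
move: rel'; set a0 := `|_|%N; set b0 := `|_|%N => rel'.
have a0E : a0%:Z = (a %% N)%Z by rewrite /a0 gez0_abs // modz_ge0 //; lia.
have b0E : b0%:Z = (b %% N)%Z by rewrite /b0 gez0_abs // modz_ge0 //; lia.
(* Adding [N] makes the exponent positive. *)
exists (b0 * s + N)%N; split.
- lia.
- have xs : (x = (x ^+ a0) ^+ s)%g.
    rewrite -expgnA -{1}[x]expg1; apply: eq_expg_mod xN _.
    by apply: eqmodz_nat; rewrite PoszM a0E modzMml.
  rewrite {1}xs conjXg rel' -expgnA expgnDr xN mulg1 //.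
- rewrite PoszD PoszM mulrDr -modzDmr modzMl addr0 mulrCA -modzMmr as1.
  by rewrite modzMmr mulr1 b0E modz_mod.
Qed.

Lemma conj_iter (G : groupType) (x y : G) (al k m : nat) :
  (x ^ y = x ^+ al -> (x ^+ m) ^ (y ^+ k) = x ^+ (m * al ^ k)%N)%g.
Proof.
move=> xy; elim: k => [|k IH]; first by rewrite expg0 conjg1 expn0 muln1.
by rewrite expgSr conjgM IH conjXg xy -expgnA expnS mulnCA.
Qed.

(** Moving [y] past a power of [z], which maps [<y>] into itself, leaves an
    error in [<y>]: [y^-1 z^k = z^k (y^-1)^(z^k)]. *)
Lemma conj_by_normalized (G : groupType) (y z : G) (be k : nat) :
  (y ^ z = y ^+ be -> (z ^+ k) ^ y = z ^+ k * y ^- (be ^ k)%N * y)%g.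
Proof.
move=> yz; rewrite conjgE mulgA [(y^-1 * _)%g]conjgC conjVg.
by have := conj_iter k 1 yz; rewrite expg1 mul1n => ->.
Qed.

(** Both sides are the conjugate of [x] by [y ^ z], once as [y ^+ be] and once
    as [z^-1 y z]. *)
Lemma mennicke_relation (G : groupType) (x y z : G) (al be ga : nat) :
  (0 < ga)%N ->
  (x ^ y = x ^+ al -> y ^ z = y ^+ be -> z ^ x = z ^+ ga ->
   x ^+ (al ^ be)%N
     = x ^+ al * z ^- (ga ^ al)%N * z ^+ ga * y ^- (be ^ ga)%N * y ^+ be)%g.
Proof.
case: ga => // j _ xy yz zx.
have -> : (x ^+ (al ^ be)%N = x ^ (y ^ z))%g.
  by rewrite yz -{2}[x]expg1 (conj_iter _ _ xy) mul1n.
have -> : (y ^ z = z^-1 * (y * z))%g by [].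
have xz : (x ^ z^-1 = x * z ^+ j)%g.
  by rewrite conjgE invgK mulgA [(z * x)%g]conjgC zx expgSr mulgA mulgK.
rewrite !conjgM xz.
have -> : ((x * z ^+ j) ^ y = x ^+ al * (z ^+ j * y ^- (be ^ j)%N * y))%g.
  by rewrite conjMg xy (conj_by_normalized _ yz).
rewrite (conjMg (x ^+ al)%g) (conjMg (z ^+ j * _)%g) (conjMg (z ^+ j)%g).
have -> : ((y ^- (be ^ j)%N) ^ z = y ^- (be ^ j.+1)%N)%g.
  by rewrite conjVg conjXg yz -expgnA expnS.
rewrite (conj_by_normalized _ zx) yz.
have -> : ((z ^+ j) ^ z = z ^+ j)%g by rewrite conjXg conjgE mulKg.
by rewrite expgS !mulgA.
Qed.

(** Writing [X], [Y], [Z] for the powers [x^(al^be - al)], [y^(be^ga - be)],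
    [z^(ga^al - ga)], the previous relation says [Y^-1 = Z X].  Conjugation by
    [y] fixes [Y], multiplies [Z] on the right by an element of [<y>] and
    raises [X] to the power [al]; so [X^(al - 1)] lies in [<y>] and is
    therefore fixed by [y]. *)
Lemma mennicke_exponent (G : groupType) (x y z : G) (al be ga : nat) :
  (0 < al)%N -> (0 < be)%N -> (0 < ga)%N ->
  (x ^ y = x ^+ al -> y ^ z = y ^+ be -> z ^ x = z ^+ ga ->
   x ^+ ((al ^ be.-1 - 1) * (al - 1) ^ 2)%N = 1)%g.
Proof.
move=> al0 be0 ga0 xy yz zx.
have := mennicke_relation ga0 xy yz zx.
set e := (al ^ be - al)%N; set p := (ga ^ al - ga)%N; set q := (be ^ ga - be)%N.
have le_pow u v : (0 < u)%N -> (0 < v)%N -> (u <= u ^ v)%N.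
  by move=> u0 v0; rewrite -{1}(expn1 u) leq_pexp2l.
have -> : (al ^ be = al + e)%N by rewrite subnKC // le_pow.
have -> : (ga ^ al = ga + p)%N by rewrite subnKC // le_pow.
have -> : (be ^ ga = be + q)%N by rewrite subnKC // le_pow.
rewrite !expgnDr !invgM -!mulgA => /mulgI.
rewrite mulKg mulVg mulg1 => X_eq.
have yq_eq : (y ^- q = z ^+ p * x ^+ e)%g by rewrite X_eq mulVKg.
pose w := (x ^+ (e * (al - 1)))%g; pose t := (y ^- (be ^ p)%N * y)%g.
have ty : (t ^ y = t)%g.
  by rewrite /t conjMg conjVg conjXg conjgE mulKg.
have tw : (t * w = 1)%g.
  have : (y ^- q ^ y = y ^- q)%g by rewrite conjVg conjXg conjgE mulKg.
  rewrite yq_eq conjMg (conj_by_normalized _ yz) conjXg xy -expgnA -mulgA.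
  rewrite -mulgA => /mulgI; rewrite mulgA -/t.
  have -> : (al * e = e * (al - 1) + e)%N by nia.
  by rewrite expgnDr mulgA -{2}[(x ^+ e)%g]mul1g => /mulIg.
have wy : (w ^ y = w)%g.
  by rewrite -(mulg1_eq tw) conjVg ty.
have w1 : (x ^+ (e * (al - 1) * (al - 1)) = 1)%g.
  apply: (@mulgI _ w); rewrite mulg1 -{2}wy /w conjXg xy -!expgnA -expgnDr.
  by congr (_ ^+ _)%g; nia.
(* The remaining factor [al] is removed by undoing a conjugation by [y]. *)
set k := ((al ^ be.-1 - 1) * (al - 1) ^ 2)%N.
apply: (@conjg_inj _ y); rewrite conj1g conjXg xy -expgnA -w1.
congr (_ ^+ _)%g; rewrite /k /e -{2}(prednK be0) (expnS al) -mulnn.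
set u := (al ^ be.-1)%N.
have -> : (al * u - al = al * (u - 1))%N by rewrite mulnBr muln1.
by rewrite !mulnA.
Qed.

(** Multiplication by [a^(m+2)] homogenizes the exponent, replacing [al] by
    the pair [(a, b)]. *)
Lemma dvd_exponent_bound (a b : int) (al m N : nat) :
  (a * al%:Z = b %[mod N])%Z ->
  (N%:Z %| (al%:Z ^+ m - 1) * (al%:Z - 1) ^+ 2)%Z ->
  (N%:Z %| (b - a) ^+ 2 * (b ^+ m - a ^+ m))%Z.
Proof.
move=> /eqP; rewrite eqz_mod_dvd => /dvdzP[v hv].
have -> : b = a * al%:Z - v * N%:Z by rewrite -hv; ring.
set A := a * al%:Z; set B := A - v * N%:Z => Nd.
have /dvdzP[u hu] : (N%:Z %| A ^+ m - B ^+ m)%Z.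
  by rewrite subrXX dvdz_mulr // /B; apply/dvdzP; exists v; ring.
have -> : B ^+ m = A ^+ m - u * N%:Z by rewrite -hu; ring.
have {Nd} /dvdzP[t ht] : (N%:Z %| (A ^+ m - a ^+ m) * (A - a) ^+ 2)%Z.
  have -> : (A ^+ m - a ^+ m) * (A - a) ^+ 2
    = a ^+ m * a ^+ 2 * ((al%:Z ^+ m - 1) * (al%:Z - 1) ^+ 2).
    by rewrite /A exprMn; ring.
  exact: dvdz_mull.
(* [B = A - v N] and [B ^+ m = A ^+ m - u N]: the multiple of [N] by which the
   expression at [B] differs from the one at [A]. *)
apply/dvdzP; exists (t - u * (B - a) ^+ 2
  - (A ^+ m - a ^+ m) * (2 * v * (A - a) - v ^+ 2 * N%:Z)).
rewrite mulrBl mulrBl -ht /B; ring.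
Qed.

(** It remains to trade [al^(be-1)] for [al^(d-c)].  Powers of [al] modulo
    the order of [x] depend only on the exponent modulo the order [M] of [y],
    and [c (be - 1) = d - c] modulo [M]; so [al^(be-1) - 1] divides
    [al^(d-c) - 1] modulo the order of [x]. *)
Lemma order_dvd_bound (G : groupType) (x y z : G) (a b c d e f : int)
    (N : nat) :
  gcdz a b = 1 -> gcdz c d = 1 -> gcdz e f = 1 -> c < d ->
  (intexp x a ^ y)%g = intexp x b ->
  (intexp y c ^ z)%g = intexp y d ->
  (intexp z e ^ x)%g = intexp z f ->
  has_order x N -> finite_order y -> finite_order z ->
  (N%:Z %| (b - a) ^+ 2 * (b ^+ `|d - c|%N - a ^+ `|d - c|%N))%Z.
Proof.
move=> ab cd ef ltcd relx rely relz oN /finite_order_has_order[M oM].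
move=> /finite_order_has_order[L oL].
have [al [al0 xy aal]] := conj_exponent oN ab relx.
have [be [be0 yz cbe]] := conj_exponent oM cd rely.
have [ga [ga0 zx _]] := conj_exponent oL ef relz.
have [[N0 oNP] [M0 _]] := (oN, oM).
have := mennicke_exponent al0 be0 ga0 xy yz zx.
move/oNP => dN; apply: (dvd_exponent_bound aal).
set m := `|d - c|%N.
have mE : m%:Z = d - c by rewrite gez0_abs // subr_ge0 ltW.
(* [c] may be negative, but the exponents of [al] are natural numbers. *)
pose c' := `|(c %% M)%Z|%N.
have c'E : c'%:Z = (c %% M)%Z by rewrite /c' gez0_abs // modz_ge0 //; lia.
have em : (be.-1 * c')%N = m %[mod M].
  apply: eqmodz_nat; rewrite PoszM c'E modzMmr mE.
  have -> : be.-1%:Z = be%:Z - 1 by rewrite -subn1 subzn.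
  apply/eqP; move/eqP: cbe; rewrite !eqz_mod_dvd.
  by have -> : (be%:Z - 1) * c - (d - c) = c * be%:Z - d by ring.
have /(has_order_eq oN) alm : (x ^+ (al ^ (be.-1 * c'))%N = x ^+ (al ^ m)%N)%g.
  have := conj_iter (be.-1 * c') 1 xy; rewrite expg1 mul1n => <-.
  have := conj_iter m 1 xy; rewrite expg1 mul1n => <-.
  by rewrite (eq_expg_mod (has_order_exp oM) em).
have {}dN : (N%:Z %| (al%:Z ^+ be.-1 - 1) * (al%:Z - 1) ^+ 2)%Z.
  by rewrite !expr2 -!rmorphXn !subzn ?expn_gt0 ?al0 // dvdzE -!PoszM mulnn.
have -> : al%:Z ^+ m - 1
  = (al%:Z ^+ (be.-1 * c') - 1) - (al%:Z ^+ (be.-1 * c') - al%:Z ^+ m) by ring.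
rewrite mulrBl rpredB //.
  by rewrite exprM subrX1 mulrAC dvdz_mulr.
rewrite dvdz_mulr // -!rmorphXn -eqz_mod_dvd; apply/eqP.
by rewrite !modz_nat alm.
Qed.

(** * Existence and lifting property of the universal quotient *)

Definition cyclic_relations (G : groupType) (a b c d e f : int) (x y z : G) :=
  [/\ (intexp x a ^ y)%g = intexp x b,
      (intexp y c ^ z)%g = intexp y d
    & (intexp z e ^ x)%g = intexp z f].

Lemma cyclic_relations_image (G H : groupType) (phi : {multiplicative G -> H})
    (a b c d e f : int) (x y z : G) :
  cyclic_relations a b c d e f x y z ->
  cyclic_relations a b c d e f (phi x) (phi y) (phi z).
Proof.
case=> rx ry rz.
by split; rewrite -!multiplicative_intexp -multiplicativeJ ?rx ?ry ?rz.
Qed.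

Definition order_bound (a b : int) (m : nat) : int :=
  (b - a) ^+ 2 * (b ^+ m - a ^+ m).

Lemma gcd_pow_diff (a b : int) (m : nat) :
  gcdz a b = 1 -> (0 < m)%N -> gcdz a (b ^+ m - a ^+ m) = 1.
Proof.
move=> ab m0; have /eqP : coprimez a (b ^+ m) by apply/coprimezXr/eqP.
by rewrite -(gcdzMDl (- a ^+ m.-1)) mulNr -exprSr prednK // addrC.
Qed.

(** Equal powers have bases of equal absolute value, and coprime integers of
    equal absolute value are units. *)
Lemma pow_diff_neq0 (a b : int) (m : nat) :
  gcdz a b = 1 -> ~ (`|a| = 1 /\ `|b| = 1) -> (0 < m)%N -> b ^+ m - a ^+ m != 0.
Proof.
move=> ab nab m0; rewrite subr_eq0; apply/eqP => /(congr1 Num.norm).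
rewrite !normrX => /eqP; rewrite eqrXn2 // => /eqP abE; apply: nab.
have abN : `|b|%N = `|a|%N by lia.
by move: ab; rewrite /gcdz abN gcdnn => aN; split; lia.
Qed.

Lemma Grel_eval (a b c d e f : int) (H : groupType) (v : gen -> H) :
  (forall u w, Grel a b c d e f u w -> word_eval v u = word_eval v w) <->
  cyclic_relations a b c d e f (v gx) (v gy) (v gz).
Proof.
have E : forall i j m n,
    word_eval v (wconj (wexp (wgen i) m) (wgen j))
    = word_eval v (wexp (wgen i) n)
    <-> (intexp (v i) m ^ v j)%g = intexp (v i) n.
  by move=> i j m n; rewrite word_eval_conj !word_eval_exp !word_eval_gen.
split=> [vR|[rx ry rz] u w].
  by split; apply/E/vR; constructor.
by case; apply/E.
Qed.

(** A presentation of [Q(a,b;c,d;e,f)]: the relations of [G] and the bounds on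
    the orders of the three generators. *)
Variant Qrel (a b c d e f : int) : word gen -> word gen -> Prop :=
| Qrel_G u v of Grel a b c d e f u v : Qrel a b c d e f u v
| Qrel_x : Qrel a b c d e f
    (wexp (wgen gx) (order_bound a b `|d - c|%N)) [::]
| Qrel_y : Qrel a b c d e f
    (wexp (wgen gy) (order_bound c d `|f - e|%N)) [::]
| Qrel_z : Qrel a b c d e f
    (wexp (wgen gz) (order_bound e f `|b - a|%N)) [::].

Lemma Qrel_eval (a b c d e f : int) (H : groupType) (v : gen -> H) :
  gcdz a b = 1 -> gcdz c d = 1 -> gcdz e f = 1 -> a < b -> c < d -> e < f ->
  cyclic_relations a b c d e f (v gx) (v gy) (v gz) ->
  (forall i, finite_order (v i)) ->
  forall u w, Qrel a b c d e f u w -> word_eval v u = word_eval v w.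
Proof.
move=> ab cd ef ltab ltcd ltef rel fin u w; have [rx ry rz] := rel.
case=> [{}u {}w|||]; first exact: (proj2 (Grel_eval a b c d e f v) rel).
- have [N oN] := finite_order_has_order (fin gx).
  rewrite word_eval_exp word_eval_gen; apply/(has_order_intexp _ oN).
  exact: (order_dvd_bound ab cd ef ltcd rx ry rz oN).
- have [N oN] := finite_order_has_order (fin gy).
  rewrite word_eval_exp word_eval_gen; apply/(has_order_intexp _ oN).
  exact: (order_dvd_bound cd ef ab ltef ry rz rx oN).
- have [N oN] := finite_order_has_order (fin gz).
  rewrite word_eval_exp word_eval_gen; apply/(has_order_intexp _ oN).
  exact: (order_dvd_bound ef ab cd ltab rz rx ry oN).
Qed.

(** The bounds hold in every quotient where the generators have finite order,
    so each such quotient satisfies all the relations [Qrel]. *)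
Lemma presented_universal (a b c d e f : int) :
  gcdz a b = 1 -> gcdz c d = 1 -> gcdz e f = 1 ->
  ~ (`|a| = 1 /\ `|b| = 1) -> ~ (`|c| = 1 /\ `|d| = 1) ->
  ~ (`|e| = 1 /\ `|f| = 1) -> a < b -> c < d -> e < f ->
  exists pi : {multiplicative Ggrp a b c d e f ->
               presented_group (Qrel a b c d e f)},
    universal_finite_order_quotient pi /\
    forall i, pi (pres_gen (Grel a b c d e f) i)
              = pres_gen (Qrel a b c d e f) i.
Proof.
move=> ab cd ef nab ncd nef ltab ltcd ltef.
set G := Ggrp _ _ _ _ _ _; set R := Qrel a b c d e f.
have [|pi piE] := @presented_group_lift _ (Grel a b c d e f)
  (presented_group R) (pres_gen R).
  move=> u w uw; rewrite !word_eval_pres_gen; apply/pres_classP/pres_rel.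
  exact: Qrel_G.
have piG w : pi (pres_class _ w) = pres_class R w.
  by rewrite piE word_eval_pres_gen.
exists pi; split; last by move=> i; rewrite /pres_gen piG.
split; first split.
- move=> h; exists (pres_class _ (generic_quotient.repr h)).
  by rewrite piG pres_class_surj.
- have killed i n : n != 0 -> R (wexp (wgen i) n) [::] ->
      finite_order (pres_gen R i).
    move=> n0 Rn; apply: (finite_order_intexp n0).
    rewrite -(word_eval_gen (pres_gen R)) -word_eval_exp word_eval_pres_gen.
    exact/pres_classP/pres_rel.
  have neq0 m n k : gcdz m n = 1 -> ~ (`|m| = 1 /\ `|n| = 1) -> m < n ->
      (0 < k)%N -> order_bound m n k != 0.
    move=> mn nmn ltmn k0; rewrite mulf_neq0 ?pow_diff_neq0 //.
    by rewrite expf_neq0 // subr_eq0 gt_eqF.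
  move=> i; rewrite /pres_gen piG; case: i.
  + apply: killed (Qrel_x _ _ _ _ _ _); apply: neq0 => //.
    by rewrite absz_gt0 subr_eq0 gt_eqF.
  + apply: killed (Qrel_y _ _ _ _ _ _); apply: neq0 => //.
    by rewrite absz_gt0 subr_eq0 gt_eqF.
  + apply: killed (Qrel_z _ _ _ _ _ _); apply: neq0 => //.
    by rewrite absz_gt0 subr_eq0 gt_eqF.
- move=> H rho [_ rho_fin].
  pose v i := rho (pres_gen (Grel a b c d e f) i).
  have rhoE w : rho (pres_class _ w) = word_eval v w.
    by rewrite -word_eval_pres_gen word_eval_multiplicative.
  have rel : cyclic_relations a b c d e f (v gx) (v gy) (v gz).
    apply/Grel_eval => u w uw; rewrite -!rhoE; congr (rho _).
    exact/pres_classP/pres_rel.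
  have [|phi phiE] := @presented_group_lift _ R H v.
    exact: Qrel_eval.
  exists phi => g; rewrite -[g]pres_class_surj piG phiE rhoE //.
Qed.

(** The map goes through the presented quotient, from which a morphism can be
    defined as soon as the relations hold; so the target may be larger than
    the subgroup generated by [x], [y], [z], whereas the universal property of
    [pi] speaks of surjective maps. *)
Lemma universal_quotient_lift (a b c d e f : int) (Q : groupType)
    (pi : {multiplicative Ggrp a b c d e f -> Q}) (H : groupType) (x y z : H) :
  gcdz a b = 1 -> gcdz c d = 1 -> gcdz e f = 1 ->
  ~ (`|a| = 1 /\ `|b| = 1) -> ~ (`|c| = 1 /\ `|d| = 1) ->
  ~ (`|e| = 1 /\ `|f| = 1) -> a < b -> c < d -> e < f ->
  universal_finite_order_quotient pi ->
  cyclic_relations a b c d e f x y z ->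
  finite_order x -> finite_order y -> finite_order z ->
  exists psi : {multiplicative Q -> H},
    [/\ psi (pi (pres_gen (Grel a b c d e f) gx)) = x,
        psi (pi (pres_gen (Grel a b c d e f) gy)) = y
      & psi (pi (pres_gen (Grel a b c d e f) gz)) = z].
Proof.
move=> ab cd ef nab ncd nef ltab ltcd ltef [_ piU] rel fx fy fz.
have [pi0 [[pi0Q _] pi0E]] :=
  presented_universal ab cd ef nab ncd nef ltab ltcd ltef.
have [phi phiE] := piU _ _ pi0Q.
pose v (i : gen) := match i with gx => x | gy => y | gz => z end.
have [|lift liftE] := @presented_group_lift _ (Qrel a b c d e f) H v.
  by apply: Qrel_eval => // -[].
pose psi : {multiplicative Q -> H} := lift \o phi.
have psiE i : psi (pi (pres_gen (Grel a b c d e f) i)) = v i.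
  by rewrite /psi /= phiE pi0E liftE word_eval_gen.
by exists psi; split; rewrite psiE.
Qed.

(** * Finiteness and the upper bound on the order *)

(** Makes Lagrange's theorem applicable to an abstract group covered by a
    finite set. *)
Lemma finite_group_of_surjection (Q : groupType) (F : finType) (f : F -> Q) :
  (forall h, exists u, f u = h) ->
  exists (T : finGroupType) (phi : {multiplicative Q -> T})
    (phiV : {multiplicative T -> Q}), cancel phi phiV /\ cancel phiV phi.
Proof.
move=> surj; pose g h := sval (cid (surj h)).
have gK : cancel g f by move=> h; exact: svalP (cid (surj h)).
pose cQ := CanIsCountable gK.
pose Qc : countType := HB.pack (Group.sort Q) cQ.
pose fQ : isFinite Qc := CanIsFinite (gK : @cancel F Qc g f).
pose T : finGroupType := HB.pack (Group.sort Q) cQ fQ.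
have phiM : {morph (id : Q -> T) : u v / (u * v)%g} by [].
have phiVM : {morph (id : T -> Q) : u v / (u * v)%g} by [].
pose phi_mul := isMultiplicative.Build Q T id phiM.
pose phiV_mul := isMultiplicative.Build T Q id phiVM.
pose phi : {multiplicative Q -> T} := HB.pack (id : Q -> T) phi_mul.
pose phiV : {multiplicative T -> Q} := HB.pack (id : T -> Q) phiV_mul.
by exists T, phi, phiV.
Qed.

(** Conjugation by [y^-1] also maps [x] to a power of [x], because [y] has
    finite order. *)
Lemma conjV_exponent (G : groupType) (x y : G) (al L : nat) :
  (0 < L)%N -> (y ^+ L = 1 -> x ^ y = x ^+ al ->
  forall k, exists m : nat, y ^+ k * x = x ^+ m * y ^+ k)%g.
Proof.
move=> L0 yL xy k; exists (al ^ (k * L.-1))%N.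
rewrite conjgCV; congr (_ * _)%g.
have -> : (y ^- k = y ^+ (k * L.-1))%g.
  by apply/mulg1_eq; rewrite -expgnDr -mulnS prednK // mulnC expgnA yL expg1n.
by rewrite -{1}[x]expg1 (conj_iter _ _ xy) mul1n.
Qed.

(** The products [x^i y^j z^k] are stable under right multiplication by each
    generator: [z] is absorbed on the right, [y] crosses [z^k] since [<z>]
    normalizes [<y>], and [x] crosses [z^k] changing [k] since [<x>] normalizes
    [<z>], then crosses [y^j] changing [i] since [<y>] normalizes [<x>]. *)
Lemma triple_product_exhausts (G : groupType) (v : gen -> G)
    (N M L al be ga : nat) :
  (0 < N)%N -> (0 < M)%N -> (0 < L)%N ->
  (v gx ^+ N = 1 -> v gy ^+ M = 1 -> v gz ^+ L = 1 ->
  v gx ^ v gy = v gx ^+ al -> v gy ^ v gz = v gy ^+ be ->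
  v gz ^ v gx = v gz ^+ ga ->
  forall w : word gen, exists (i : 'I_N) (j : 'I_M) (k : 'I_L),
    word_eval v w = v gx ^+ i * v gy ^+ j * v gz ^+ k)%g.
Proof.
move=> N0 M0 L0 xN yM zL xy yz zx.
pose P g := exists i j k : nat, g = (v gx ^+ i * v gy ^+ j * v gz ^+ k)%g.
have Px g : P g -> P (g * v gx)%g.
  move=> [i [j [k ->]]]; have [m E] := conjV_exponent M0 yM xy j.
  exists (i + m)%N, j, (k * ga)%N.
  rewrite -mulgA [(v gz ^+ k * _)%g]conjgC conjXg zx -expgnA.
  rewrite [(ga * k)%N]mulnC mulgA.
  by rewrite -[(_ * v gx)%g]mulgA E expgnDr !mulgA.
have Py g : P g -> P (g * v gy)%g.
  move=> [i [j [k ->]]]; have [m E] := conjV_exponent L0 zL yz k.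
  by exists i, (j + m)%N, k; rewrite -mulgA E expgnDr !mulgA.
have Pz g : P g -> P (g * v gz)%g.
  by move=> [i [j [k ->]]]; exists i, j, k.+1; rewrite expgSr mulgA.
have Pgen i g : P g -> P (g * v i)%g.
  by case: i; [exact: Px|exact: Py|exact: Pz].
have Pexp i m g : P g -> P (g * v i ^+ m)%g.
  by elim: m g => [|m IH] g Pg; rewrite ?mulg1 // expgS mulgA; apply/IH/Pgen.
have inv_exp i : exists m, (v i)^-1%g = (v i ^+ m)%g.
  by case: i; [exists N.-1 | exists M.-1 | exists L.-1];
     apply/mulg1_eq; rewrite -expgS prednK.
have Pw w g : P g -> P (g * word_eval v w)%g.
  elim: w g => [|[i s] w IH] g Pg; first by rewrite /= mulg1.
  rewrite /= mulgA; apply: IH; case: s => /=; last exact: Pgen.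
  by have [m ->] := inv_exp i; apply: Pexp.
move=> w; have [|i [j [k wE]]] := Pw w 1%g.
  by exists 0%N, 0%N, 0%N; rewrite !expg0 !mulg1.
exists (Ordinal (ltn_pmod i N0)), (Ordinal (ltn_pmod j M0)),
  (Ordinal (ltn_pmod k L0)).
rewrite mul1g in wE; rewrite wE /=.
by congr (_ * _ * _)%g; [apply: (eq_expg_mod xN)|apply: (eq_expg_mod yM)
  |apply: (eq_expg_mod zL)]; rewrite modn_mod.
Qed.

(** [<x><y>] is a subgroup because [<y>] normalizes [<x>]; the order of a
    product of two subgroups divides the product of their orders, which is
    used for [<x><y>] and for [(<x><y>)<z>]. *)
Lemma card_triple_product_dvd (T : finGroupType) (x y z : T) :
  (forall g, exists i j k : nat, g = x ^+ i * y ^+ j * z ^+ k)%g ->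
  (exists al : nat, x ^ y = x ^+ al)%g ->
  (#|T| %| #[x]%g * #[y]%g * #[z]%g)%N.
Proof.
move=> exh [al xy].
have nxy : (<[y]> \subset 'N(<[x]>))%g.
  rewrite cycle_subG; apply/normP; apply/eqP.
  by rewrite eqEcard cardJg leqnn andbT -cycleJ cycle_subG xy mem_cycle.
have TE : ([set: T] = (<[x]> <*> <[y]>) * <[z]>)%g.
  apply/setP => g; rewrite inE; apply/esym.
  have [i [j [k ->]]] := exh g.
  rewrite mem_mulg ?mem_cycle // groupM // mem_gen // inE mem_cycle ?orbT //.
have := mul_cardG (<[x]> <*> <[y]>)%G <[z]>%G.
rewrite -TE cardsT => E1.
apply: (@dvdn_trans (#|(<[x]> <*> <[y]>)%g| * #[z]%g)%N).
  by rewrite E1 dvdn_mulr.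
rewrite dvdn_pmul2r ?order_gt0 //.
have := mul_cardG <[x]>%G <[y]>%G; rewrite -norm_joinEr // => E2.
by rewrite /order E2 dvdn_mulr.
Qed.

(** A finite group isomorphic to [Q], in which the upper bound is read off the
    orders of the three generators. *)
Lemma finite_model (a b c d e f : int) (Q : groupType)
    (pi : {multiplicative Ggrp a b c d e f -> Q}) :
  gcdz a b = 1 -> gcdz c d = 1 -> gcdz e f = 1 ->
  finite_order_quotient pi ->
  exists (T : finGroupType) (phi : {multiplicative Q -> T})
    (phiV : {multiplicative T -> Q}),
    let v i := phi (pi (pres_gen (Grel a b c d e f) i)) in
    [/\ cancel phi phiV, cancel phiV phi,
        cyclic_relations a b c d e f (v gx) (v gy) (v gz)
      & (#|T| %| #[v gx]%g * #[v gy]%g * #[v gz]%g)%N].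
Proof.
move=> ab cd ef [surj fin].
pose v i := pi (pres_gen (Grel a b c d e f) i).
have piE w : pi (pres_class _ w) = word_eval v w.
  by rewrite -word_eval_pres_gen word_eval_multiplicative.
have rel : cyclic_relations a b c d e f (v gx) (v gy) (v gz).
  apply/Grel_eval => u w uw; rewrite -!piE; congr (pi _).
  exact/pres_classP/pres_rel.
have [rx ry rz] := rel.
have [N oN] := finite_order_has_order (fin gx).
have [M oM] := finite_order_has_order (fin gy).
have [L oL] := finite_order_has_order (fin gz).
have [al [_ xy _]] := conj_exponent oN ab rx.
have [be [_ yz _]] := conj_exponent oM cd ry.
have [ga [_ zx _]] := conj_exponent oL ef rz.
have exh := triple_product_exhausts oN.1 oM.1 oL.1 (has_order_exp oN)
  (has_order_exp oM) (has_order_exp oL) xy yz zx.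
have exhQ h : exists (i : 'I_N) (j : 'I_M) (k : 'I_L),
    h = (v gx ^+ i * v gy ^+ j * v gz ^+ k)%g.
  have [g <-] := surj h.
  rewrite -[g]pres_class_surj piE; exact: exh.
pose F (u : 'I_N * 'I_M * 'I_L) :=
  (v gx ^+ u.1.1 * v gy ^+ u.1.2 * v gz ^+ u.2)%g.
have [|T [phi [phiV [phiK phiVK]]]] := finite_group_of_surjection (f := F).
  by move=> h; have [i [j [k ->]]] := exhQ h; exists (i, j, k).
exists T, phi, phiV; split=> //; first exact: cyclic_relations_image rel.
apply: card_triple_product_dvd.
  move=> g; have [i [j [k E]]] := exhQ (phiV g); exists i, j, k.
  by rewrite -[g]phiVK E !gmulfM !multiplicativeX.
by exists al; rewrite -multiplicativeX -multiplicativeJ -xy.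
Qed.

(** * The lower bound on the order *)

(** Two affine permutations of Z/n: [tau] is the translation by 1 and [mu] the
    multiplication by [u].  The multiplication is an iterated addition, so that
    the case [n = 1] is covered. *)
Lemma affine_group (n u : nat) :
  (0 < n)%N -> coprime n u ->
  exists (T : finGroupType) (tau mu : T),
    [/\ has_order tau n, (tau ^ mu = tau ^+ u)%g
      & forall k, u ^ k = 1 %[mod n] -> (mu ^+ k = 1)%g].
Proof.
case: n => // p _ co.
have t_inj : injective (fun t : 'I_p.+1 => t + inZp 1) by move=> s t /addIr.
have m_inj : injective (fun t : 'I_p.+1 => t *+ u).
  move=> s t /(congr1 val); rewrite /= !Zp_mulrn /=.
  move=> st; have : (s%:Z * u%:Z == t%:Z * u%:Z %[mod p.+1])%Z.
    by rewrite -!PoszM !modz_nat st.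
  rewrite eqz_mod_dvd -mulrBl Gauss_dvdzl ?coprimezE //.
  by rewrite -eqz_mod_dvd !modz_nat !modn_small // => /eqP[]/val_inj.
pose tau := perm t_inj; pose mu := perm m_inj.
have tauE k t : (tau ^+ k)%g t = t + inZp k.
  elim: k => [|k IH].
    by rewrite expg0 perm1; apply: val_inj; rewrite /= mod0n addn0 modn_small.
  rewrite expgSr permM IH permE -addrA; congr (_ + _).
  by apply: val_inj; rewrite /= modnDm addn1.
have muE k t : (mu ^+ k)%g t = t *+ (u ^ k).
  elim: k => [|k IH]; first by rewrite expg0 perm1.
  by rewrite expgSr permM IH permE -mulrnA expnSr.
exists {perm 'I_p.+1}, tau, mu; split.
- split=> // k; split=> [/permP/(_ 0)|kp].
    by rewrite tauE perm1 add0r => /(congr1 val) /= /eqP.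
  apply/permP => t; rewrite tauE perm1; apply: val_inj => /=.
  by move/eqP: kp => ->; rewrite addn0 modn_small.
- apply: (@mulgI _ mu); rewrite conjgE mulVKg; apply/permP => t.
  rewrite !permM tauE !permE mulrnDl; congr (_ + _).
  by rewrite Zp_mulrn; apply: val_inj; rewrite /= modnMml mul1n.
- move=> k uk; apply/permP => t; rewrite muE perm1.
  rewrite Zp_mulrn; apply: val_inj => /=.
  by rewrite -modnMmr uk modnMmr muln1 modn_small.
Qed.

(** With [u] representing b/a modulo [n], the commutator is the translation by
    [u - 1], and [a (u - 1) = b - a] modulo [n]. *)
Lemma metacyclic_quotient (a b : int) (n m : nat) :
  (0 < n)%N -> gcdz a n = 1 -> (b ^+ m = a ^+ m %[mod n])%Z ->
  gcdz b n = 1 ->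
  exists (T : finGroupType) (tau mu : T),
    [/\ (intexp tau a ^ mu)%g = intexp tau b, (mu ^+ m = 1)%g
      & (n%:Z %| (b - a) * #[[~ tau, mu]]%g%:Z)%Z].
Proof.
move=> n0 an bam bn.
have [s [v sv]] := Bezoutz a n; rewrite an in sv.
(* Adding [n] makes [u] positive, so that [u.-1] represents [u - 1]. *)
pose u := (`|(s * b %% n)%Z| + n)%N.
have uE : (u%:Z = s * b %[mod n])%Z.
  by rewrite PoszD modzDr gez0_abs ?modz_mod // modz_ge0 //; lia.
have dvd_mod (i j : int) : (i = j %[mod n])%Z <-> (n%:Z %| i - j)%Z.
  by rewrite -eqz_mod_dvd; split=> [->|/eqP].
have auE : (a * u%:Z = b %[mod n])%Z.
  rewrite -modzMmr uE modzMmr; apply/dvd_mod; apply/dvdzP.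
  exists (- v * b); rewrite -[X in _ - X]mul1r -sv; ring.
have co : coprime n u.
  suff: gcdz (a * u%:Z) n = 1.
    rewrite /gcdz absz_nat => -[] /eqP.
    rewrite abszM absz_nat -/(coprime _ _) coprimeMl => /andP[_].
    by rewrite coprime_sym.
  by rewrite -gcdz_modl auE gcdz_modl.
have [T [tau [mu [otau conj mu_ord]]]] := affine_group n0 co.
have tau_n := has_order_exp otau.
exists T, tau, mu; split.
- rewrite !(intexp_mod _ n0 tau_n) conjXg conj -expgnA.
  apply: eq_expg_mod tau_n _; apply: eqmodz_nat.
  rewrite PoszM gez0_abs ?modz_ge0 //; last by lia.
  rewrite gez0_abs ?modz_ge0 //; last by lia.
  by rewrite modzMmr modz_mod mulrC.
- apply: mu_ord; apply: eqmodz_nat.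
  have /dvd_mod : ((a * u%:Z) ^+ m = a ^+ m %[mod n])%Z.
    by rewrite -modzXm auE modzXm.
  rewrite exprMn -{2}[a ^+ m]mulr1 -mulrBr Gauss_dvdzr.
    by rewrite -rmorphXn => /dvd_mod.
  by rewrite coprimezXr // coprimez_sym; apply/eqP.
- set o := #[_]%g.
  have u0 : (0 < u)%N by rewrite addn_gt0 n0 orbT.
  have comE : [~ tau, mu]%g = (tau ^+ u.-1)%g.
    by rewrite commgEl conj -{1}(prednK u0) expgS mulKg.
  have : ([~ tau, mu] ^+ o = 1)%g by apply: expg_order.
  rewrite comE -expgnA; case: otau => _ oP /oP dn.
  have {}dn : (n%:Z %| (u%:Z - 1) * o%:Z)%Z.
    by rewrite subzn // subn1.
  have -> : (b - a) * o%:Z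
    = a * ((u%:Z - 1) * o%:Z) - (a * u%:Z - b) * o%:Z by ring.
  by apply: rpredB; [apply: dvdz_mull|apply/dvdz_mulr/dvd_mod].
Qed.

(** The index of the kernel of [psi] in [K] is the order of the image of [K],
    a multiple of the order of each of its elements. *)
Lemma kernel_step (Q H : finGroupType) (psi : {multiplicative Q -> H})
    (K : {group Q}) (w : Q) :
  w \in K ->
  exists K' : {group Q},
    (#[psi w]%g * #|K'| %| #|K|)%N /\
    (forall g, g \in K -> psi g = 1%g -> g \in K').
Proof.
move=> Kw; have psiM : {in K &, {morph psi : g h / (g * h)%g}}.
  by move=> g h _ _; rewrite gmulfM.
pose p := Morphism psiM; exists ('ker p)%G; split; last first.
  by move=> g Kg pg; apply/kerP.
have sKK : ('ker p \subset K)%g by apply: subsetIl.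
have imE : (#|p @* K| = #|K : 'ker p|)%g by rewrite card_morphim finset.setIid.
rewrite -(Lagrange sKK) mulnC dvdn_mul // -imE.
by apply: order_dvdG; apply/morphimP; exists w.
Qed.

(** The form in which universality is used on finite groups; it is invariant
    under the rotation of the generators. *)
Definition lifts_cyclic_relations (Q : finGroupType) (a b c d e f : int)
    (x y z : Q) :=
  forall (H : finGroupType) (x' y' z' : H),
    cyclic_relations a b c d e f x' y' z' ->
    exists psi : {multiplicative Q -> H},
      [/\ psi x = x', psi y = y' & psi z = z'].

Lemma lifts_cyclic_relations_rot (Q : finGroupType) (a b c d e f : int)
    (x y z : Q) :
  lifts_cyclic_relations a b c d e f x y z ->
  lifts_cyclic_relations c d e f a b y z x.
Proof.
move=> lift H x' y' z' [r1 r2 r3].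
by have [psi [p1 p2 p3]] := lift H z' x' y' (And3 r3 r1 r2); exists psi.
Qed.

(** The map to the cyclic group of order [b - a] that sends [x] to a generator
    and kills [y] and [z]. *)
Lemma abelian_witness (Q : finGroupType) (a b c d e f : int) (x y z : Q) :
  a < b -> lifts_cyclic_relations a b c d e f x y z ->
  exists (H : finGroupType) (psi : {multiplicative Q -> H}),
    [/\ psi y = 1%g, psi z = 1%g & #[psi x]%g%:Z = b - a].
Proof.
move=> ltab lift; pose n := `|b - a|%N.
have n0 : (0 < n)%N by rewrite absz_gt0 subr_eq0 gt_eqF.
have [H [s [_ [os _ _]]]] := affine_group n0 (coprimen1 n).
have [|psi [px py pz]] := lift H s 1%g 1%g; last first.
  exists H, psi; split=> //; rewrite px.
  have -> : (#[s]%g = n)%N.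
    case: os => _ oP; apply/eqP; rewrite eqn_dvd order_dvdn.
    by apply/andP; split; [apply/eqP/oP|apply/oP/expg_order].
  by rewrite /n gez0_abs // subr_ge0 ltW.
split; rewrite ?intexp1 ?conj1g ?conjg1 //.
apply: eq_intexp_mod n0 (has_order_exp os) _.
by apply/eqP; rewrite eqz_mod_dvd /n dvdzE absz_nat -abszN opprB.
Qed.

(** Sends [x] to the translation, [y] to the multiplication and [z] to 1.  The
    relation between [y] and [z] becomes [y^c = y^d], which holds because
    (b/a)^(d-c) is 1 modulo [b^(d-c) - a^(d-c)]. *)
Lemma metacyclic_witness (Q : finGroupType) (a b c d e f : int) (x y z : Q) :
  gcdz a b = 1 -> ~ (`|a| = 1 /\ `|b| = 1) -> c < d ->
  lifts_cyclic_relations a b c d e f x y z ->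
  exists (H : finGroupType) (psi : {multiplicative Q -> H}),
    psi z = 1%g /\
    (b ^+ `|d - c|%N - a ^+ `|d - c|%N %| (b - a) * #[psi [~ x, y]]%g%:Z)%Z.
Proof.
move=> ab nab ltcd lift; set m := `|d - c|%N; pose n := `|b ^+ m - a ^+ m|%N.
have m0 : (0 < m)%N by rewrite absz_gt0 subr_eq0 gt_eqF.
have n0 : (0 < n)%N by rewrite /n absz_gt0 pow_diff_neq0.
have an : gcdz a n = 1.
  by rewrite /gcdz absz_nat -/(gcdz a (b ^+ m - a ^+ m)) gcd_pow_diff.
have bn : gcdz b n = 1.
  rewrite /n distnC /gcdz absz_nat -/(gcdz b (a ^+ m - b ^+ m)).
  by rewrite gcd_pow_diff // gcdzC.
have bam : (b ^+ m = a ^+ m %[mod n])%Z.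
  by apply/eqP; rewrite eqz_mod_dvd /n dvdzE absz_nat.
have [H [tau [mu [r1 muX dv]]]] := metacyclic_quotient n0 an bam bn.
have [|psi [px py pz]] := lift H tau mu 1%g; last first.
  exists H, psi; split=> //; rewrite multiplicativeR px py.
  by move: dv; rewrite !dvdzE absz_nat.
split; rewrite ?intexp1 ?conj1g ?conjg1 //.
apply: eq_intexp_mod m0 muX _.
by apply/eqP; rewrite eqz_mod_dvd /m dvdzE absz_nat -abszN opprB.
Qed.

(** Starting from [Q], the kernels of three cyclic and three affine maps are
    intersected one after the other.  At each stage a suitable element is
    still available: the three generators first, then the commutators, which
    the cyclic maps kill, and each of which only one of the affine maps
    detects. *)
Lemma card_lower_bound (Q : finGroupType) (a b c d e f : int) (x y z : Q) :
  gcdz a b = 1 -> gcdz c d = 1 -> gcdz e f = 1 ->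
  ~ (`|a| = 1 /\ `|b| = 1) -> ~ (`|c| = 1 /\ `|d| = 1) ->
  ~ (`|e| = 1 /\ `|f| = 1) -> a < b -> c < d -> e < f ->
  lifts_cyclic_relations a b c d e f x y z ->
  ((b ^+ `|d - c|%N - a ^+ `|d - c|%N) * (d ^+ `|f - e|%N - c ^+ `|f - e|%N)
   * (f ^+ `|b - a|%N - e ^+ `|b - a|%N) %| #|Q|%:Z)%Z.
Proof.
move=> ab cd ef nab ncd nef ltab ltcd ltef lx.
have ly := lifts_cyclic_relations_rot lx.
have lz := lifts_cyclic_relations_rot ly.
have [H1 [t1 [t1y t1z t1x]]] := abelian_witness ltab lx.
have [H2 [t2 [t2z t2x t2y]]] := abelian_witness ltcd ly.
have [H3 [t3 [t3x t3y t3z]]] := abelian_witness ltef lz.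
have [H4 [p1 [p1z D1]]] := metacyclic_witness ab nab ltcd lx.
have [H5 [p2 [p2x D2]]] := metacyclic_witness cd ncd ltef ly.
have [H6 [p3 [p3y D3]]] := metacyclic_witness ef nef ltab lz.
have [K1 [c1 k1]] := kernel_step t1 (finset.in_setT x : x \in [set: Q]%G).
rewrite cardsT in c1.
have K1y : y \in K1 by apply: k1; rewrite ?inE.
have K1z : z \in K1 by apply: k1; rewrite ?inE.
have K1c u v : (t1 [~ u, v] = 1 -> [~ u, v] \in K1)%g by apply: k1; rewrite inE.
have [K2 [c2 k2]] := kernel_step t2 K1y.
have [K3 [c3 k3]] := kernel_step t3 (k2 _ K1z t2z).
have triv (H : finGroupType) (t : {multiplicative Q -> H}) u v :
    t u = 1%g \/ t v = 1%g -> t [~ u, v]%g = 1%g.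
  by rewrite multiplicativeR => -[->|->]; rewrite ?comm1g ?commg1.
have K3xy : [~ x, y]%g \in K3.
  by apply: k3; [apply: k2; [apply: K1c|]|]; apply: triv; auto.
have K3yz : [~ y, z]%g \in K3.
  by apply: k3; [apply: k2; [apply: K1c|]|]; apply: triv; auto.
have K3zx : [~ z, x]%g \in K3.
  by apply: k3; [apply: k2; [apply: K1c|]|]; apply: triv; auto.
have [K4 [c4 k4]] := kernel_step p1 K3xy.
have K4yz : [~ y, z]%g \in K4 by apply: k4 => //; apply: triv; auto.
have K4zx : [~ z, x]%g \in K4 by apply: k4 => //; apply: triv; auto.
have [K5 [c5 k5]] := kernel_step p2 K4yz.
have K5zx : [~ z, x]%g \in K5 by apply: k5 => //; apply: triv; auto.
have [K6 [c6 _]] := kernel_step p3 K5zx.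
have dvd_chain (o k k' n r : nat) :
    (o * k %| k')%N -> (r * k' %| n)%N -> (r * o * k %| n)%N.
  by move=> ok; apply: dvdn_trans; rewrite -mulnA dvdn_mul.
move: (dvd_chain _ _ _ _ _ c6 (dvd_chain _ _ _ _ _ c5 (dvd_chain _ _ _ _ _ c4
  (dvd_chain _ _ _ _ _ c3 (dvd_chain _ _ _ _ _ c2 c1))))).
set o1 := #[_]%g; set o2 := #[_]%g; set o3 := #[_]%g.
set o4 := #[_]%g; set o5 := #[_]%g; set o6 := #[_]%g => dv.
have : ((b - a) * o4%:Z * ((d - c) * o5%:Z) * ((f - e) * o6%:Z)
        %| #|Q|%:Z)%Z.
  rewrite -t1x -t2y -t3z -/o1 -/o2 -/o3 -!PoszM dvdzE !absz_nat.
  apply: dvdn_trans dv; rewrite -(_ : o1 * o4 * (o2 * o5) * (o3 * o6)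
    = o1 * o2 * o3 * o4 * o5 * o6)%N; last by ring.
  exact: dvdn_mulr.
by apply: dvdz_trans; apply: dvdz_mul D3; apply: dvdz_mul D1 D2.
Qed.

(** * The order of the universal quotient *)

Local Open Scope classical_set_scope.
Local Open Scope card_scope.
Local Open Scope ring_scope.

Lemma card_eq_finite_model (Q : groupType) (T : finType) (phi : Q -> T)
    (phiV : T -> Q) :
  cancel phi phiV -> cancel phiV phi -> [set: Q] #= `I_(#|T|).
Proof.
move=> phiK phiVK; apply/card_set_bijP.
exists (fun h => enum_rank (phi h) : nat); split.
- by move=> h _ /=.
- move=> g h _ _ /val_inj/enum_rank_inj; exact: can_inj.
- move=> i /= lt_i; exists (phiV (enum_val (Ordinal lt_i))) => //.
  by rewrite phiVK enum_valK.
Qed.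

Unset Implicit Arguments.

Theorem theorem15 (a b c d e f : int)
    (ha : a != 0) (hb : b != 0) (hc : c != 0)
    (hd : d != 0) (he : e != 0) (hf : f != 0)
    (hab : gcdz a b = 1) (hcd : gcdz c d = 1) (hef : gcdz e f = 1)
    (nab : ~ (`|a| = 1 /\ `|b| = 1))
    (ncd : ~ (`|c| = 1 /\ `|d| = 1))
    (nef : ~ (`|e| = 1 /\ `|f| = 1))
    (ltab : a < b) (ltcd : c < d) (ltef : e < f) :
  (exists (Q : groupType) (pi : {multiplicative Ggrp a b c d e f -> Q}),
      universal_finite_order_quotient pi) /\
  (forall (Q : groupType) (pi : {multiplicative Ggrp a b c d e f -> Q}),
      universal_finite_order_quotient pi ->
      exists n : nat, [set: Q] #= `I_n /\
      exists k : int,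
        (k %| (b - a) ^+ 2 * (d - c) ^+ 2 * (f - e) ^+ 2)%Z /\
        n%:Z = (b ^ (d - c) - a ^ (d - c)) * (d ^ (f - e) - c ^ (f - e))
               * (f ^ (b - a) - e ^ (b - a)) * k).
Proof.
split.
  have [pi [piU _]] :=
    presented_universal hab hcd hef nab ncd nef ltab ltcd ltef.
  by eexists; exists pi.
move=> Q pi piU.
have [T [phi [phiV [phiK phiVK rel card_dvd]]]] :=
  finite_model hab hcd hef piU.1.
move: rel card_dvd; set x := phi _; set y := phi _; set z := phi _.
move=> rel card_dvd.
exists #|T|; split; first exact: card_eq_finite_model phiK phiVK.
have expz_abs (u v w : int) : v < w -> u ^ (w - v) = u ^+ `|w - v|%N.
  by move=> vw; rewrite exprnP gez0_abs // subr_ge0 ltW.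
rewrite !expz_abs //.
have lift : lifts_cyclic_relations a b c d e f x y z.
  move=> H x' y' z' rel'.
  have [psi [px py pz]] := universal_quotient_lift hab hcd hef nab ncd nef
    ltab ltcd ltef piU rel' (finite_order_fin _) (finite_order_fin _)
    (finite_order_fin _).
  by exists (psi \o phiV : {multiplicative T -> H}); split; rewrite /= phiK.
have [rx ry rz] := rel.
have dx := order_dvd_bound hab hcd hef ltcd rx ry rz (has_order_order x)
  (finite_order_fin y) (finite_order_fin z).
have dy := order_dvd_bound hcd hef hab ltef ry rz rx (has_order_order y)
  (finite_order_fin z) (finite_order_fin x).
have dz := order_dvd_bound hef hab hcd ltab rz rx ry (has_order_order z)
  (finite_order_fin x) (finite_order_fin y).
have := card_lower_bound hab hcd hef nab ncd nef ltab ltcd ltef lift.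
have exp_gt0 (u v : int) : u < v -> (0 < `|v - u|)%N.
  by move=> uv; rewrite absz_gt0 subr_eq0 gt_eqF.
have := pow_diff_neq0 hab nab (exp_gt0 _ _ ltcd).
have := pow_diff_neq0 hcd ncd (exp_gt0 _ _ ltef).
have := pow_diff_neq0 hef nef (exp_gt0 _ _ ltab).
move: dx dy dz; set A := b ^+ _ - _; set B := d ^+ _ - _; set C := f ^+ _ - _.
move: A B C => A B C dx dy dz C0 B0 A0 /dvdzP[k kE].
exists k; split; last by rewrite kE mulrC.
have ABC0 : A * B * C != 0 by rewrite !mulf_neq0.
rewrite -(@dvdz_mul2r (A * B * C)) // -kE.
have -> : (b - a) ^+ 2 * (d - c) ^+ 2 * (f - e) ^+ 2 * (A * B * C)
  = ((b - a) ^+ 2 * A) * ((d - c) ^+ 2 * B) * ((f - e) ^+ 2 * C) by ring.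
apply: (@dvdz_trans (#[x]%g * #[y]%g * #[z]%g)%N%:Z).
  by rewrite dvdzE.
by rewrite !PoszM !dvdz_mul.
Qed.
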